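(* Let $n\ge 2$ and let $\mathcal{Q}_{2n}$ be the $2n$-dimensional complex filiform Lie algebra with basis $\{e_1,\dots,e_{2n}\}$ and brackets $$[e_1,e_i]=-[e_i,e_1]=e_{i+1},\quad 2\le i\le 2n-2,\qquad [e_{2n+1-i},e_i]=-[e_i,e_{2n+1-i}]=(-1)^i e_{2n},\quad 2\le i\le n,$$ all other brackets of basis elements being zero. Let $\varphi:\mathcal{Q}_{2n}\to\mathfrak{gl}(2n,\mathbb{C})$ be the linear map $$a_1e_1+a_2e_2+\dots+a_{2n}e_{2n}\mapsto\begin{pmatrix} 0&a_2&-a_3&\dots&a_{2n-2}&-a_{2n-1}&-2a_{2n}\\ 0&0&a_1&\dots&0&0&a_{2n-1}\\ 0&0&0&\dots&0&0&a_{2n-2}\\ \vdots&\vdots&\vdots&\ddots&\vdots&\vdots&\vdots\\ 0&0&0&\dots&0&a_1&a_3\\ 0&0&0&\dots&0&0&a_2\\ 0&0&0&\dots&0&0&0 \end{pmatrix},$$ that is, $\varphi(e_1)=\sum_{k=2}^{2n-2}E_{k,k+1}$, $\varphi(e_i)=(-1)^iE_{1,i}+E_{2n-i+1,2n}$ for $2\le i\le 2n-1$, and $\varphi(e_{2n})=-2E_{1,2n}$. Then $\varphi$ is a minimal faithful representation of $\mathcal{Q}_{2n}$: it is an injective Lie algebra homomorphism, and no faithful representation of $\mathcal{Q}_{2n}$ has dimension smaller than $2n$.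
   Context: All Lie algebras and representations are finite-dimensional over $\mathbb{C}$. $\mathfrak{gl}(m,\mathbb{C})$ is the Lie algebra of complex $m\times m$ matrices with bracket $[A,B]=AB-BA$, and $E_{i,j}$ is the matrix whose $(i,j)$ entry is $1$ and whose other entries are $0$. A representation of dimension $m$ of a Lie algebra $\mathfrak{g}$ is a Lie algebra homomorphism $\mathfrak{g}\to\mathfrak{gl}(m,\mathbb{C})$; it is faithful if it is injective. Set $\mu(\mathfrak{g})=\min\{\dim M \mid M \text{ is a faithful } \mathfrak{g}\text{-module}\}$; a faithful representation is called minimal if its dimension equals $\mu(\mathfrak{g})$. A Lie algebra $L$ of dimension $m$ is filiform if $\dim L^i=m-i$ for $2\le i\le m$, where $L^1=L$ and $L^{k+1}=[L,L^k]$. *)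

(* Defs.v *)
From HB Require Import structures.
From mathcomp Require Import all_boot all_order all_algebra.
From mathcomp Require Import ring zify.

Set Implicit Arguments.
Unset Strict Implicit.
Unset Printing Implicit Defensive.

Import GRing.Theory.
Local Open Scope ring_scope.

HB.mixin Record Vector_isLieAlgebra (K : fieldType) L of Vector K L := {
  lie : L -> L -> L;
  lie_linearl : forall y, linear (lie^~ y);
  lie_linearr : forall x, linear (lie x);
  liexx : forall x, lie x x = 0;
  jacobi : forall x y z,
    lie x (lie y z) + lie y (lie z x) + lie z (lie x y) = 0
}.

#[short(type="lieAlgType")]
HB.structure Definition LieAlgebra (K : fieldType) :=
  { L of Vector K L & Vector_isLieAlgebra K L }.

Section LieTheory.
Variables (K : fieldType) (L : lieAlgType K).

Lemma lieDl (x y z : L) : lie (x + y) z = lie x z + lie y z.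
Proof. by have := lie_linearl z 1 x y; rewrite !scale1r. Qed.

Lemma lieDr (x y z : L) : lie x (y + z) = lie x y + lie x z.
Proof. by have := lie_linearr x 1 y z; rewrite !scale1r. Qed.

Lemma lie0l (x : L) : lie 0 x = 0.
Proof. by apply: (addIr (lie 0 x)); rewrite -lieDl !add0r. Qed.

Lemma lie0r (x : L) : lie x 0 = 0.
Proof. by apply: (addIr (lie x 0)); rewrite -lieDr !add0r. Qed.

Lemma lieZl a (x y : L) : lie (a *: x) y = a *: lie x y.
Proof. by have := lie_linearl y a x 0; rewrite !addr0 lie0l addr0. Qed.

Lemma lieZr a (x y : L) : lie x (a *: y) = a *: lie x y.
Proof. by have := lie_linearr x a y 0; rewrite !addr0 lie0r addr0. Qed.

Lemma lie_suml I (r : seq I) (P : pred I) (F : I -> L) y :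
  lie (\sum_(i <- r | P i) F i) y = \sum_(i <- r | P i) lie (F i) y.
Proof. by apply: (big_morph (lie^~ y)) => [u v|]; rewrite ?lieDl ?lie0l. Qed.

Lemma lie_sumr I (r : seq I) (P : pred I) (F : I -> L) x :
  lie x (\sum_(i <- r | P i) F i) = \sum_(i <- r | P i) lie x (F i).
Proof. by apply: (big_morph (lie x)) => [u v|]; rewrite ?lieDr ?lie0r. Qed.

(* By bilinearity, brackets of basis vectors suffice to span [U, V]. *)
Definition lie_prodv (U V : {vspace L}) : {vspace L} :=
  <<[seq lie u v | u <- vbasis U, v <- vbasis V]>>%VS.

Lemma memv_lie (U V : {vspace L}) x y :
  x \in U -> y \in V -> lie x y \in lie_prodv U V.
Proof.
move=> xU yV; rewrite (coord_vbasis xU) (coord_vbasis yV) lie_suml.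
apply: memv_suml => i _; rewrite lie_sumr; apply: memv_suml => j _.
rewrite lieZl lieZr; apply/memvZ/memvZ/memv_span/allpairsP.
by exists ((vbasis U)`_i, (vbasis V)`_j); rewrite !mem_nth ?size_tuple.
Qed.

Lemma lie_prodv_sub (U V W : {vspace L}) :
    (forall x y, x \in U -> y \in V -> lie x y \in W) ->
  (lie_prodv U V <= W)%VS.
Proof.
move=> sUVW; apply/span_subvP => _ /allpairsP [[u v] /= [uU vV ->]].
by apply: sUVW; apply: vbasis_mem.
Qed.

(* Indexed so that L^1 = L and L^(k+1) = [L, L^k]; L^0 = L is a dummy value. *)
Definition lower_central (k : nat) : {vspace L} :=
  iter k.-1 (lie_prodv fullv) fullv.

Definition filiform : Prop :=
  forall i, (2 <= i <= \dim {:L})%N ->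
    \dim (lower_central i) = (\dim {:L} - i)%N.

End LieTheory.

Definition gl (K : fieldType) (m : nat) : Type := 'M[K]_m.

Section GeneralLinear.
Variables (K : fieldType) (m : nat).
Implicit Types A B C : 'M[K]_m.

HB.instance Definition _ := Vector.on (gl K m).

Definition mx_lie A B : 'M[K]_m := A *m B - B *m A.

Fact mx_lie_linearl B : linear (mx_lie^~ B).
Proof.
move=> a A1 A2; rewrite /mx_lie mulmxDl mulmxDr -scalemxAl -scalemxAr.
by rewrite scalerBr opprD addrACA.
Qed.

Fact mx_lie_linearr A : linear (mx_lie A).
Proof.
move=> a B1 B2; rewrite /mx_lie mulmxDl mulmxDr -scalemxAl -scalemxAr.
by rewrite scalerBr opprD addrACA.
Qed.

Fact mx_liexx A : mx_lie A A = 0.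
Proof. exact: subrr. Qed.

Fact mx_jacobi A B C :
  mx_lie A (mx_lie B C) + mx_lie B (mx_lie C A) + mx_lie C (mx_lie A B) = 0.
Proof.
rewrite /mx_lie !mulmxBr !mulmxBl !mulmxA !opprB.
set a := A *m B *m C; set b := A *m C *m B; set c := B *m C *m A.
set d := C *m B *m A; set f := B *m A *m C; set g := C *m A *m B.
by apply/matrixP => i j; rewrite !mxE; move: (a i j) (b i j) (c i j) (d i j)
  (f i j) (g i j) => {}a {}b {}c {}d {}f {}g;
  ring.
Qed.

HB.instance Definition _ := Vector_isLieAlgebra.Build K (gl K m)
  mx_lie_linearl mx_lie_linearr mx_liexx mx_jacobi.

End GeneralLinear.

Section Representations.
Variable K : fieldType.

Definition lie_morphism (g h : lieAlgType K) (f : g -> h) : Prop :=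
  linear f /\ {morph f : x y / lie x y}.

Definition representation (g : lieAlgType K) (m : nat) (rho : g -> gl K m) :=
  lie_morphism rho.

Definition faithful_rep (g : lieAlgType K) (m : nat) (rho : g -> gl K m) :=
  representation rho /\ injective rho.

(* d = mu(g) as a relation, so that no appeal to Ado's theorem is needed. *)
Definition is_mu (g : lieAlgType K) (d : nat) : Prop :=
  (exists rho : g -> gl K d, faithful_rep rho) /\
  (forall (m : nat) (rho : g -> gl K m), faithful_rep rho -> (d <= m)%N).

Definition minimal_faithful_rep (g : lieAlgType K) (m : nat)
    (rho : g -> gl K m) : Prop :=
  faithful_rep rho /\ is_mu g m.

End Representations.

(* In the rest of the file indices are numbered from 1, as usual for bases and
   matrix units; an index outside the range yields 0. *)
Definition unit_mx (K : fieldType) (p q i j : nat) : 'M[K]_(p, q) :=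
  \matrix_(k, l) ((k.+1 == i) && (l.+1 == j))%:R.

(* The vectors of Q_2n are the rows of their coordinates in e_1, ..., e_2n. *)
Definition Qfil (K : fieldType) (n : nat) : Type := 'rV[K]_(n.*2).

HB.instance Definition _ (K : fieldType) (n : nat) := Vector.on (Qfil K n).

Section Qfil.
Variables (K : fieldType) (n : nat).
Local Notation Q := (Qfil K n).

Definition qe (k : nat) : Q := unit_mx K 1 n.*2 1 k.

Definition qcoord (k : nat) (x : Q) : K :=
  \sum_(j < n.*2 | j.+1 == k) (x : 'rV[K]_(n.*2)) 0 j.

(* The bilinear extension of the brackets of basis vectors, which are recovered
   in qlie_e1, qlie_mirror and qlie_other below. *)
Definition qlie (x y : Q) : Q :=
    \sum_(2 <= i < n.*2.-1)
      (qcoord 1 x * qcoord i y - qcoord i x * qcoord 1 y) *: qe i.+1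
  + \sum_(2 <= i < n.+1)
      ((-1) ^+ i * (qcoord (n.*2.+1 - i) x * qcoord i y
                    - qcoord i x * qcoord (n.*2.+1 - i) y)) *: qe n.*2.

Lemma qcoordE x (j : 'I_(n.*2)) : qcoord j.+1 x = (x : 'rV_(n.*2)) 0 j.
Proof.
rewrite /qcoord (bigD1 j) //= big1 ?addr0 // => i /andP [/eqP [ij]].
by rewrite (ord_inj ij) eqxx.
Qed.

Lemma qcoord_out x k : ~~ (1 <= k <= n.*2)%N -> qcoord k x = 0.
Proof.
move=> out; rewrite /qcoord big1 // => j /eqP jk; case/negP: out.
by rewrite -jk /=.
Qed.

Lemma qcoordP (x y : Q) :
  (forall k, (1 <= k <= n.*2)%N -> qcoord k x = qcoord k y) -> x = y.
Proof.
by move=> eqxy; apply/rowP => j; rewrite -!qcoordE; apply: eqxy => /=.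
Qed.

Fact qcoord_linear k : scalar (qcoord k).
Proof.
move=> a x y; rewrite /qcoord mulr_sumr -big_split /=.
by apply: eq_bigr => j _; rewrite !mxE.
Qed.

HB.instance Definition _ k :=
  GRing.isLinear.Build K Q K *%R (qcoord k) (qcoord_linear k).

Lemma qcoord0 k : qcoord k 0 = 0.
Proof. exact: linear0. Qed.

Lemma qcoordD k x y : qcoord k (x + y) = qcoord k x + qcoord k y.
Proof. exact: linearD. Qed.

Lemma qcoordZ k a x : qcoord k (a *: x) = a * qcoord k x.
Proof. exact: (linearZ_LR (qcoord k)). Qed.

Lemma qcoord_sum k I (r : seq I) (P : pred I) (F : I -> Q) :
  qcoord k (\sum_(i <- r | P i) F i) = \sum_(i <- r | P i) qcoord k (F i).
Proof. exact: linear_sum. Qed.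

Lemma qcoord_e i k : (1 <= k <= n.*2)%N -> qcoord k (qe i) = (k == i)%:R.
Proof. by case: k => // k /= kn; rewrite (qcoordE _ (Ordinal kn)) !mxE. Qed.

Lemma qcoord_e0 i k : k != i -> qcoord k (qe i) = 0.
Proof.
move=> ki; have [kn|kn] := boolP (1 <= k <= n.*2)%N; last exact: qcoord_out.
by rewrite qcoord_e // (negPf ki).
Qed.

Lemma qcoord_ee k : (1 <= k <= n.*2)%N -> qcoord k (qe k) = 1.
Proof. by move=> kn; rewrite qcoord_e // eqxx. Qed.

Lemma qbasis_sum (x : Q) : x = \sum_(1 <= i < n.*2.+1) qcoord i x *: qe i.
Proof.
apply: qcoordP => k kn; rewrite qcoord_sum (bigD1_seq k) ?iota_uniq //=;
  last by rewrite mem_index_iota.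
rewrite qcoordZ qcoord_e // eqxx mulr1 big1 ?addr0 // => i ik.
by rewrite qcoordZ qcoord_e // eq_sym (negPf ik) mulr0.
Qed.

Definition qomega (x y : Q) : K :=
  \sum_(2 <= i < n.*2) (-1) ^+ i * (qcoord (n.*2.+1 - i) x * qcoord i y).

Lemma qomegaE x y :
  qomega x y = \sum_(2 <= i < n.+1)
      ((-1) ^+ i * (qcoord (n.*2.+1 - i) x * qcoord i y
                    - qcoord i x * qcoord (n.*2.+1 - i) y)).
Proof.
have [n1|n1] := leqP n 1; first by rewrite /qomega !big_geq //; lia.
rewrite /qomega (big_cat_nat (n := n.+1)) /=; [|lia|lia].
under [RHS]eq_bigr do rewrite mulrBr.
rewrite big_split /=; congr (_ + _).
rewrite [in LHS](_ : n.+1 = 2 + n.-1)%N; last by lia.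
rewrite big_addn [in LHS](_ : n.*2 - n.-1 = n.+1)%N; last by lia.
rewrite big_nat_rev; apply: eq_big_nat => i /andP [i2 ile] /=.
rewrite (_ : 2 + n.+1 - i.+1 + n.-1 = n.*2.+1 - i)%N; last by lia.
rewrite subKn; last by lia.
rewrite -signr_odd oddB; last by lia.
by rewrite /= odd_double /= -[in RHS]signr_odd; case: (odd i) => /=; ring.
Qed.

Lemma qlie_coord1 x y k : (k <= 2)%N -> (1 < n)%N -> qcoord k (qlie x y) = 0.
Proof.
move=> k2 n1; have [k0|k0] := posnP k; first by apply: qcoord_out; lia.
rewrite /qlie qcoordD !qcoord_sum !big_nat !big1 ?addr0 // => i /andP [i2 il].
  by rewrite qcoordZ qcoord_e0 ?mulr0 //; apply/eqP; lia.
by rewrite qcoordZ qcoord_e0 ?mulr0 //; apply/eqP; lia.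
Qed.

Lemma qlie_coord x y k : (2 < k < n.*2)%N ->
  qcoord k (qlie x y) =
  qcoord 1 x * qcoord k.-1 y - qcoord k.-1 x * qcoord 1 y.
Proof.
move=> /andP [k2 kn]; rewrite /qlie qcoordD !qcoord_sum.
rewrite [X in _ + X]big1 ?addr0 => [|i _]; last first.
  by rewrite qcoordZ qcoord_e0 ?mulr0 //; apply/eqP; lia.
rewrite (bigD1_seq k.-1) ?iota_uniq ?mem_index_iota /=; [|lia|by []].
rewrite prednK ?qcoordZ ?qcoord_ee ?mulr1; [|lia..].
rewrite big1 ?addr0 // => i ik.
by rewrite qcoordZ qcoord_e0 ?mulr0 //; apply/eqP; lia.
Qed.

Lemma qlie_coord_last x y : (1 < n)%N ->
  qcoord n.*2 (qlie x y) = qomega x y.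
Proof.
move=> n1; rewrite /qlie qcoordD !qcoord_sum big_nat big1 ?add0r; last first.
  move=> i /andP [i2 il].
  by rewrite qcoordZ qcoord_e0 ?mulr0 //; apply/eqP; lia.
rewrite qomegaE; apply: eq_bigr => i _.
by rewrite qcoordZ qcoord_ee ?mulr1 //; lia.
Qed.

Lemma qlie_small x y : (n <= 1)%N -> qlie x y = 0.
Proof. by move=> n1; rewrite /qlie !big_geq ?addr0 //; lia. Qed.

Lemma qlieC x y : qlie x y = - qlie y x.
Proof.
rewrite /qlie opprD -!sumrN; congr (_ + _); apply: eq_bigr => i _;
  by rewrite -scaleNr; congr (_ *: _); ring.
Qed.

Fact qliexx x : qlie x x = 0.
Proof.
by rewrite /qlie !big1 ?addr0 // => i _;
  rewrite [qcoord i x * _]mulrC subrr ?mulr0 scale0r.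
Qed.

Fact qlie_linearl y : linear (qlie^~ y).
Proof.
move=> a x1 x2; have [n1|n1] := leqP n 1.
  by rewrite !qlie_small // scaler0 addr0.
apply: qcoordP => k /andP [k1 kn] /=; rewrite [RHS]qcoordD qcoordZ.
have [k2|k2] := leqP k 2; first by rewrite !qlie_coord1 // mulr0 addr0.
have [kn'|kn'] := ltnP k n.*2.
  by rewrite !qlie_coord ?k2 // !qcoordD !qcoordZ; ring.
have -> : k = n.*2 by lia.
rewrite !qlie_coord_last // /qomega mulr_sumr -big_split /=.
by apply: eq_bigr => i _; rewrite !qcoordD !qcoordZ; ring.
Qed.

Fact qlie_linearr x : linear (qlie x).
Proof.
move=> a y1 y2; rewrite qlieC qlie_linearl opprD -scalerN.
by rewrite -!(qlieC x).
Qed.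

Lemma qomega_lie x y z : (1 < n)%N ->
  qomega x (qlie y z) =
    qcoord 1 y * (\sum_(3 <= i < n.*2)
       (-1) ^+ i * (qcoord (n.*2.+1 - i) x * qcoord i.-1 z))
  - qcoord 1 z * (\sum_(3 <= i < n.*2)
       (-1) ^+ i * (qcoord (n.*2.+1 - i) x * qcoord i.-1 y)).
Proof.
move=> n1; rewrite /qomega big_ltn; last by lia.
rewrite qlie_coord1 // !mulr0 add0r !mulr_sumr -sumrB.
by apply: eq_big_nat => i i2; rewrite qlie_coord //; ring.
Qed.

Lemma qshift_sym x z : (1 < n)%N ->
  \sum_(3 <= i < n.*2) (-1) ^+ i * (qcoord (n.*2.+1 - i) x * qcoord i.-1 z) =
  \sum_(3 <= i < n.*2) (-1) ^+ i * (qcoord (n.*2.+1 - i) z * qcoord i.-1 x).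
Proof.
move=> n1; rewrite big_nat_rev; apply: eq_big_nat => i i3 /=.
rewrite (_ : n.*2.+1 - (3 + n.*2 - i.+1) = i.-1)%N; last by lia.
rewrite (_ : (3 + n.*2 - i.+1).-1 = n.*2.+1 - i)%N; last by lia.
rewrite (_ : 3 + n.*2 - i.+1 = n.*2.+2 - i)%N; last by lia.
rewrite -signr_odd oddB; last by lia.
by rewrite /= odd_double /= signr_odd; ring.
Qed.

Fact qjacobi x y z :
  qlie x (qlie y z) + qlie y (qlie z x) + qlie z (qlie x y) = 0.
Proof.
have [n1|n1] := leqP n 1; first by rewrite !qlie_small // !addr0.
apply: qcoordP => k /andP [k1 kn].
rewrite [LHS]qcoordD [X in X + _]qcoordD [RHS]qcoord0.
have [k2|k2] := leqP k 2; first by rewrite !qlie_coord1 // !addr0.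
have [kn'|kn'] := ltnP k n.*2.
  rewrite !(@qlie_coord _ _ k) ?k2 // !(@qlie_coord1 _ _ 1) // !mulr0 !subr0.
  have [k3|k3] := leqP k.-1 2; first by rewrite !qlie_coord1 // !mulr0 !addr0.
  by rewrite !qlie_coord; [ring|lia..].
have -> : k = n.*2 by lia.
rewrite !qlie_coord_last // !qomega_lie //.
by rewrite (qshift_sym x z) // (qshift_sym y z) // (qshift_sym x y) //; ring.
Qed.

HB.instance Definition _ := Vector_isLieAlgebra.Build K Q
  qlie_linearl qlie_linearr qliexx qjacobi.

Lemma qdim : \dim {:Q} = n.*2.
Proof. by rewrite dimvf /dim /= mul1n. Qed.

Definition qtail (k : nat) : {vspace Q} :=
  <<[seq qe i | i <- iota k.+1 (n.*2 - k)]>>%VS.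

Lemma qtailP k x :
  reflect (forall j, (j <= k)%N -> qcoord j x = 0) (x \in qtail k).
Proof.
apply: (iffP idP) => [/coord_span -> j jk | x0].
  rewrite qcoord_sum big1 // => i _; rewrite qcoordZ.
  have il := ltn_ord i.
  rewrite /= (nth_map 0%N) ?size_iota // nth_iota //.
  by rewrite qcoord_e0 ?mulr0 //; apply/eqP; lia.
rewrite (qbasis_sum x) big_seq; apply: memv_suml => i.
rewrite mem_index_iota => il; have [ik|ik] := leqP i k.
  by rewrite x0 // scale0r mem0v.
by apply/memvZ/memv_span/map_f; rewrite mem_iota; lia.
Qed.

Lemma qbasis : basis_of fullv [seq qe i | i <- iota 1 n.*2].
Proof.
rewrite basisEdim size_map size_iota qdim leqnn andbT.
apply/subvP => x _; have -> : iota 1 n.*2 = iota 1 (n.*2 - 0) by rewrite subn0.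
by apply/qtailP => j; rewrite leqn0 => /eqP ->; apply: qcoord_out.
Qed.

Lemma dim_qtail k : (k <= n.*2)%N -> \dim (qtail k) = (n.*2 - k)%N.
Proof.
move=> kn; have /andP [_] := qbasis.
rewrite -[in iota _ _](subnKC kn) iotaD map_cat add1n => /catr_free.
by rewrite /free size_map size_iota => /eqP.
Qed.

Lemma qomega_e a b : (1 <= a <= n.*2)%N -> (1 <= b <= n.*2)%N ->
  qomega (qe a) (qe b) =
  if (1 < b < n.*2)%N && (a + b == n.*2.+1) then (-1) ^+ b else 0.
Proof.
move=> an bn; case: ifPn => [/andP [b2 /eqP ab]|nab].
  rewrite /qomega (bigD1_seq b) ?iota_uniq ?mem_index_iota //=.
  rewrite (_ : n.*2.+1 - b = a)%N ?qcoord_ee ?mulr1 //; last by lia.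
  by rewrite big1 ?addr0 // => i ib; rewrite (@qcoord_e0 b) // !mulr0.
rewrite /qomega big_nat big1 // => i i2; have [ib|ib] := eqVneq i b; last first.
  by rewrite (@qcoord_e0 b) // !mulr0.
subst i; rewrite qcoord_e0 ?mul0r ?mulr0 //; apply/eqP => ab.
by case/negP: nab; lia.
Qed.

Lemma qlie_e1 i : (2 <= i <= n.*2 - 2)%N -> lie (qe 1) (qe i) = qe i.+1.
Proof.
move=> i2; have n1 : (1 < n)%N by lia.
apply: qcoordP => k /andP [k1 kn].
have [k2|k2] := leqP k 2.
  by rewrite qlie_coord1 // qcoord_e0 //; apply/eqP; lia.
have [kn'|kn'] := ltnP k n.*2.
  rewrite qlie_coord ?k2 // (@qcoord_e0 i 1) ?mulr0 ?subr0; last by lia.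
  by rewrite qcoord_ee ?mul1r ?qcoord_e; [congr (_%:R); lia|lia..].
have -> : k = n.*2 by lia.
rewrite qlie_coord_last // qomega_e ?qcoord_e0; [|apply/eqP; lia|lia..].
by case: ifP => //; lia.
Qed.

Lemma qlie_mirror i : (2 <= i <= n)%N ->
  lie (qe (n.*2.+1 - i)) (qe i) = (-1) ^+ i *: qe n.*2.
Proof.
move=> i2; have n1 : (1 < n)%N by lia.
apply: qcoordP => k /andP [k1 kn]; rewrite [RHS]qcoordZ.
have [k2|k2] := leqP k 2.
  by rewrite qlie_coord1 // qcoord_e0 ?mulr0 //; apply/eqP; lia.
have [kn'|kn'] := ltnP k n.*2.
  rewrite qlie_coord ?k2 // (@qcoord_e0 _ 1) ?mul0r; last by apply/eqP; lia.
  rewrite (@qcoord_e0 i 1) ?mulr0 ?subr0; last by apply/eqP; lia.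
  by rewrite qcoord_e0 ?mulr0 //; apply/eqP; lia.
have -> : k = n.*2 by lia.
rewrite qlie_coord_last // qomega_e ?qcoord_ee ?mulr1; [|lia..].
by rewrite ifT //; lia.
Qed.

Lemma qlie_other i j : (1 <= i <= j)%N -> (j <= n.*2)%N ->
    ~~ ((i == 1) && (2 <= j <= n.*2 - 2))%N ->
    ~~ ((2 <= i) && (i + j == n.*2.+1))%N ->
  lie (qe i) (qe j) = 0.
Proof.
move=> ij jn ij1 ij2; have [n1|n1] := leqP n 1; first exact: qlie_small.
apply: qcoordP => k /andP [k1 kn]; rewrite [RHS]qcoord0.
have [k2|k2] := leqP k 2; first by rewrite qlie_coord1.
have [kn'|kn'] := ltnP k n.*2.
  rewrite qlie_coord ?k2 // !qcoord_e; [|lia..]; rewrite -!natrM !mulnb.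
  have -> : (1%N == i) && (k.-1 == j) = false by lia.
  have -> : (k.-1 == i) && (1%N == j) = false by lia.
  by rewrite subrr.
have -> : k = n.*2 by lia.
by rewrite qlie_coord_last // qomega_e ?ifF //; lia.
Qed.

Lemma lower_centralQ k : (1 < n)%N -> (2 <= k <= n.*2)%N ->
  lower_central Q k = qtail k.
Proof.
move=> n1 /andP [k2 kn].
case: k k2 kn => // k; rewrite ltnS; elim: k => // k IHk _ kn.
apply/eqP; rewrite eqEsubv; apply/andP; split.
  rewrite /lower_central /=; apply: lie_prodv_sub => x y _ yk.
  apply/qtailP => j jk.
  have [j2|j2] := leqP j 2; first by rewrite qlie_coord1.
  have {}yk : forall i, (i < j)%N -> qcoord i y = 0.
    case: (posnP k) => [k0|k0] i ij; first by lia.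
    have yk' : y \in qtail k.+1 by rewrite -IHk //; lia.
    by apply: (qtailP _ _ yk'); lia.
  have [jn|jn] := ltnP j n.*2.
    by rewrite qlie_coord ?j2 // !yk ?mulr0 ?subrr //; lia.
  have -> : j = n.*2 by lia.
  rewrite qlie_coord_last // /qomega big_nat big1 // => i i2.
  by rewrite (@yk i) ?mulr0 //; lia.
apply/span_subvP => v /mapP [i]; rewrite mem_iota => il ->.
have e_prev j : (1 <= k -> k.+2 <= j)%N ->
    qe j \in iter k (lie_prodv fullv) fullv.
  move=> kj; have [->|k0] := posnP k; first exact: memvf.
  have -> : iter k (lie_prodv fullv) fullv = qtail k.+1 by rewrite -IHk //; lia.
  by apply/qtailP => l lk; rewrite qcoord_e0 //; apply/eqP; lia.
have [i_n|i_n] := ltnP i n.*2.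
  have -> : qe i = lie (qe 1) (qe i.-1) by rewrite qlie_e1 ?prednK //; lia.
  by apply: memv_lie; [apply: memvf|apply: e_prev; lia].
have -> : qe i = - lie (qe 2) (qe n.*2.-1).
  have := @qlie_mirror 2; rewrite sqrrN expr1n scale1r => qe2n.
  have -> : i = n.*2 by lia.
  rewrite -qe2n; last by lia.
  by rewrite [LHS]qlieC; congr (- lie _ (qe _)); lia.
by rewrite memvN; apply: memv_lie; [apply: memvf|apply: e_prev; lia].
Qed.

Lemma Qfil_filiform : (1 < n)%N -> filiform Q.
Proof.
by move=> n1 i; rewrite qdim => i2; rewrite lower_centralQ // dim_qtail //; lia.
Qed.

(* The image of a_1 e_1 + ... + a_2n e_2n is the matrix with first row
   (0, a_2, - a_3, ..., a_(2n-2), - a_(2n-1), - 2 a_2n), last column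
   (- 2 a_2n, a_(2n-1), ..., a_2, 0)^T, and a_1 in the positions (k, k + 1) for
   2 <= k <= 2n - 2. *)
Definition phi (x : Q) : gl K n.*2 :=
    qcoord 1 x *: \sum_(2 <= k < n.*2.-1) unit_mx K n.*2 n.*2 k k.+1
  + \sum_(2 <= i < n.*2)
      qcoord i x *: ((-1) ^+ i *: unit_mx K n.*2 n.*2 1 i
                     + unit_mx K n.*2 n.*2 (n.*2 - i).+1 n.*2)
  + qcoord n.*2 x *: (- 2%:R *: unit_mx K n.*2 n.*2 1 n.*2).

Lemma phi_e1 : (1 < n)%N ->
  phi (qe 1) = \sum_(2 <= k < n.*2.-1) unit_mx K n.*2 n.*2 k k.+1.
Proof.
move=> n1; rewrite /phi qcoord_ee ?scale1r; last by lia.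
rewrite [X in _ + X + _]big_nat [X in _ + X + _]big1 => [|i i2].
  by rewrite addr0 qcoord_e0 ?scale0r ?addr0 //; apply/eqP; lia.
by rewrite qcoord_e0 ?scale0r //; apply/eqP; lia.
Qed.

Lemma phi_ei i : (2 <= i <= n.*2.-1)%N ->
  phi (qe i) = (-1) ^+ i *: unit_mx K n.*2 n.*2 1 i
               + unit_mx K n.*2 n.*2 (n.*2 - i).+1 n.*2.
Proof.
move=> i2; rewrite /phi (@qcoord_e0 i 1) ?scale0r ?add0r; last by apply/eqP; lia.
rewrite (@qcoord_e0 i n.*2) ?scale0r ?addr0; last by apply/eqP; lia.
rewrite (bigD1_seq i) ?iota_uniq ?mem_index_iota /=; [|lia|by []].
rewrite qcoord_ee ?scale1r; last by lia.
by rewrite big1 ?addr0 // => j ji; rewrite qcoord_e0 // scale0r.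
Qed.

Lemma phi_e2n : (1 < n)%N ->
  phi (qe n.*2) = - 2%:R *: unit_mx K n.*2 n.*2 1 n.*2.
Proof.
move=> n1; rewrite /phi qcoord_e0 ?scale0r ?add0r; last by apply/eqP; lia.
rewrite big_nat big1 => [|i i2].
  by rewrite add0r qcoord_ee ?scale1r //; lia.
by rewrite qcoord_e0 ?scale0r //; apply/eqP; lia.
Qed.

End Qfil.

(* Main.v *)
(* The lower bound holds for every Lie algebra L of nilpotency class c >= 2: a
   representation of dimension at most c kills the last nonzero term L^c of the
   lower central series. By induction on the dimension one may assume that the
   Fitting decomposition of every rho x - a is trivial, both summands being
   L-stable, so that rho x has the single eigenvalue tr (rho x) / m. Subtracting
   this character, which vanishes on brackets, makes every rho x nilpotent. By
   Engel's argument the spaces V_j = V_(j-1) L then strictly decrease to 0, and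
   V L^c is contained in V_c = 0. For Q_2n one has c = 2n - 1 and e_2n in L^c. *)
From HB Require Import structures.
Require Import Defs.
From mathcomp Require Import all_boot all_order all_algebra.
From mathcomp Require Import reals complex.
From mathcomp Require Import ring zify.

Set Implicit Arguments.
Unset Strict Implicit.
Unset Printing Implicit Defensive.

Import GRing.Theory Num.Theory.
Local Open Scope ring_scope.

(** * The lower central series *)

Section LowerCentral.
Variables (K : fieldType) (L : lieAlgType K).

Lemma lieC (x y : L) : lie x y = - lie y x.
Proof.
apply/eqP; rewrite -addr_eq0 -(liexx (x + y)).
by rewrite lieDl !lieDr !liexx add0r addr0.
Qed.

(** [U, V] is spanned by brackets, so linear conditions such as a vanishing trace need checking on
    brackets only. *)
Lemma lie_prodv_ind (P : L -> Prop) (U V : {vspace L}) :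
    P 0 -> (forall a x y, P x -> P y -> P (a *: x + y)) ->
    (forall u v, u \in U -> v \in V -> P (lie u v)) ->
  forall x, x \in lie_prodv U V -> P x.
Proof.
move=> P0 Plin Plie; rewrite /lie_prodv; set s := (X in <<X>>%VS) => x.
(* [coord_span] expects a tuple, hence the repackaging of the list. *)
rewrite -[s]/(tval (in_tuple s)) => /coord_span ->.
apply: (big_ind P) => // [y z Py Pz|i _]; first by rewrite -[y]scale1r; apply: Plin.
rewrite -[_ *: _]addr0; apply: Plin => //=.
have /allpairsP [[u v] /= [/vbasis_mem uU /vbasis_mem vV ->]] :=
  mem_nth 0 (ltn_ord i : i < size s)%N.
exact: Plie.
Qed.

Lemma lie_lower_central k x y :
  x \in lower_central L k.+1 -> lie x y \in lower_central L k.+2.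
Proof.
by move=> xL; rewrite lieC memvN; apply: memv_lie => //; apply: memvf.
Qed.

Lemma lower_centralS k : (lower_central L k.+2 <= lower_central L k.+1)%VS.
Proof.
elim: k => [|k IHk]; first exact: subvf.
by apply: lie_prodv_sub => x y _ /(subvP IHk); apply: memv_lie (memvf _).
Qed.

Lemma lower_central_ge c k :
  lower_central L c.+1 = 0%VS -> (c <= k)%N -> lower_central L k.+1 = 0%VS.
Proof.
move=> Lc0 ck; apply/eqP; rewrite -subv0 -Lc0 -(subnKC ck).
elim: (k - c)%N => [|j IHj]; first by rewrite addn0.
by rewrite addnS; apply: subv_trans (lower_centralS _) IHj.
Qed.

End LowerCentral.

(** * Engel's argument for representations by nilpotent matrices *)

Section Action.
Variables (K : fieldType) (L : lieAlgType K) (m : nat).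
Variable rho : {linear L -> 'M[K]_m}.
Hypothesis rho_lie : {morph rho : x y / lie x y >-> mx_lie x y}.
Implicit Types (U : {vspace L}) (V W T : 'M[K]_m) (x y : L).

Lemma rep_comm x y : rho x *m rho y = rho y *m rho x + rho (lie x y).
Proof. by rewrite rho_lie /mx_lie addrC subrK. Qed.

(* The row space of actmx V U is the span of all v x, v in V and x in U. *)
Definition actmx V U : 'M[K]_m :=
  (\sum_(i < \dim U) V *m rho (vbasis U)`_i)%MS.

Lemma actmx_mem V U x : x \in U -> (V *m rho x <= actmx V U)%MS.
Proof.
move=> xU; rewrite (coord_vbasis xU) linear_sum mulmx_sumr.
apply: summx_sub => i _; rewrite linearZ -scalemxAr scalemx_sub //.
by rewrite (sumsmx_sup i).
Qed.

Lemma actmx_sub V U p (W : 'M_(p, m)) :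
  (forall x, x \in U -> (V *m rho x <= W)%MS) -> (actmx V U <= W)%MS.
Proof.
move=> VUW; apply/sumsmx_subP => i _; apply: VUW.
by rewrite vbasis_mem ?mem_nth ?size_tuple.
Qed.

Lemma actmxS V U U' : (U <= U')%VS -> (actmx V U <= actmx V U')%MS.
Proof. by move=> sUU'; apply: actmx_sub => x /(subvP sUU'); apply: actmx_mem. Qed.

Definition stable p (V : 'M_(p, m)) := forall x, (V *m rho x <= V)%MS.

Definition ideal U := forall x y, x \in U -> lie x y \in U.

(** For v in V one has v x y = v y x + v [x, y]; the first term lies in V U because V is stable, the
    second because U is an ideal. *)
Lemma actmx_stable V U : stable V -> ideal U -> stable (actmx V U).
Proof.
move=> Vst Uid y; rewrite sumsmxMr; apply/sumsmx_subP => i _.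
set x := _`_i; have xU : x \in U by rewrite vbasis_mem ?mem_nth ?size_tuple.
rewrite -mulmxA rep_comm mulmxDr mulmxA addmx_sub ?actmx_mem ?Uid //.
exact: submx_trans (submxMr _ (Vst y)) (actmx_mem _ xU).
Qed.

Hypothesis rho_nil : forall x, exists N, rho x ^+ N = 0.

(* If V = T + V x with T := V U stable under x, then V = T + V x^j for every j. *)
Lemma engel_step V U x : stable V -> ideal U ->
  (V <= actmx V (<[x]> + U))%MS -> (V <= actmx V U)%MS.
Proof.
move=> Vst Uid; set T := actmx V U => sV.
have {}sV : (V <= T + V *m rho x)%MS.
  apply: submx_trans sV _; apply: actmx_sub => w.
  move=> /memv_addP [u /vlineP [a ->] [y yU ->]].
  rewrite linearD linearZ mulmxDr -scalemxAr addmx_sub //.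
    by rewrite scalemx_sub ?addsmxSr.
  exact: submx_trans (actmx_mem _ yU) (addsmxSl _ _).
have sTN j : (T *m rho x ^+ j <= T)%MS.
  elim: j => [|j IHj]; first by rewrite expr0 mulmx1.
  rewrite exprSr mulmxA; apply: submx_trans (submxMr _ IHj) _.
  exact: actmx_stable.
have sVj j : (V <= T + V *m rho x ^+ j)%MS.
  elim: j => [|j IHj]; first by rewrite expr0 mulmx1 addsmxSr.
  apply: submx_trans IHj _; rewrite addsmx_sub addsmxSl /=.
  apply: submx_trans (submxMr _ sV) _.
  by rewrite addsmxMr -mulmxA [rho x *m _](esym (exprS _ _)) addsmxS.
have [N xN0] := rho_nil x; move: (sVj N).
by rewrite xN0 mulmx0 addsmx0.
Qed.

(** The inclusion of V in V L^(k+1) propagates to V L^(k+2): [engel_step] discards the basis vectors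
    of L^(k+1) one at a time, keeping L^(k+2) throughout. At k = c nothing but 0 is left. *)
Lemma engel_lower_central V c : lower_central L c.+1 = 0%VS -> stable V ->
  (V <= actmx V fullv)%MS -> V = 0.
Proof.
move=> Lc0 Vst sV.
suffices sVk k : (V <= actmx V (lower_central L k.+1))%MS.
  apply/eqP; rewrite -submx0; apply: submx_trans (sVk c) _.
  apply: actmx_sub => x; rewrite Lc0 memv0 => /eqP ->.
  by rewrite linear0 mulmx0 sub0mx.
elim: k => // k IHk.
set U := lower_central L k.+1 in IHk.
set U' := lower_central L k.+2.
have sU'U : (U' <= U)%VS by exact: lower_centralS.
have : (V <= actmx V (<<vbasis U>> + U'))%MS.
  by apply: submx_trans IHk (actmxS _ _); rewrite (span_basis (vbasisP U)) addvSl.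
have : {subset (vbasis U : seq L) <= U} by move=> x; apply: vbasis_mem.
elim: (vbasis U : seq L) => [|x s IHs] sU; first by rewrite span_nil add0v.
rewrite span_cons -addvA => /engel_step sVs; apply: IHs.
  by move=> y ys; apply: sU; rewrite inE ys orbT.
(* The remaining space lies between L^(k+2) and L^(k+1), so its brackets with L fall into L^(k+2)
   and it is an ideal. *)
apply: sVs => // y z ysU.
apply: (subvP (addvSr _ _)); apply: lie_lower_central.
apply: subvP ysU; rewrite subv_add sU'U andbT; apply/span_subvP => t ts.
by apply: sU; rewrite inE ts orbT.
Qed.

Definition engel_flag j : 'M[K]_m := iter j (actmx^~ fullv) 1%:M.

Lemma ideal_full : ideal fullv.
Proof. by move=> x y _; apply: memvf. Qed.

Lemma engel_flag_stable j : stable (engel_flag j).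
Proof.
elim: j => [x|j IHj]; first exact: submx1.
exact: actmx_stable IHj ideal_full.
Qed.

(** By [engel_lower_central] a nonzero term of the flag differs from its successor, so each step
    loses at least one dimension until 0 is reached. *)
Lemma rank_engel_flag c j : lower_central L c.+1 = 0%VS ->
  (\rank (engel_flag j) <= m - j)%N.
Proof.
move=> Lc0; elim: j => [|j IHj]; first by rewrite mxrank1 subn0.
have s_j : (engel_flag j.+1 <= engel_flag j)%MS.
  by apply: actmx_sub => x _; apply: engel_flag_stable.
have [j0|nz] := eqVneq (engel_flag j) 0.
  by move: s_j; rewrite j0 submx0 => /eqP ->; rewrite mxrank0.
suffices : (\rank (engel_flag j.+1) < \rank (engel_flag j))%N by lia.
rewrite (ltn_leqif (mxrank_leqif_sup s_j)); apply: contra nz => sj.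
by apply/eqP; apply: engel_lower_central Lc0 (engel_flag_stable j) sj.
Qed.

(** Expand v [u, w] = (v u) w - (v w) u with w one term higher in the series: w descends by the
    inductive amount and u by one more step, in either order. *)
Lemma engel_flag_lower_central j k x : x \in lower_central L k.+1 ->
  (engel_flag j *m rho x <= engel_flag (j + k).+1)%MS.
Proof.
elim: k j x => [|k IHk] j x xL; first by rewrite addn0; apply: actmx_mem.
move: x xL; apply: (@lie_prodv_ind _ _ _ fullv (lower_central L k.+1)).
- by rewrite linear0 mulmx0 sub0mx.
- by move=> a u v su sv; rewrite linearP mulmxDr -scalemxAr addmx_sub ?scalemx_sub.
move=> u v _ vL.
rewrite rho_lie /mx_lie mulmxBr !mulmxA addmx_sub ?eqmx_opp //.
  apply: submx_trans (submxMr _ (actmx_mem _ (memvf u))) _.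
  by rewrite addnS -addSn; apply: (IHk j.+1).
rewrite addnS; apply: submx_trans (submxMr _ (IHk j v vL)) _.
exact: actmx_mem (memvf _).
Qed.

Lemma nilrep_lower_central_eq0 c x : lower_central L c.+1 = 0%VS ->
  (m <= c)%N -> x \in lower_central L c -> rho x = 0.
Proof.
case: c => [|c] Lc0 mc xL.
  (* The dummy value of [lower_central] at 0 does no harm: c = 0 forces m = 0 and the matrix is
     empty. *)
  by have m0 : m = 0%N; [lia | apply/matrixP => i; have := ltn_ord i; lia].
apply/eqP; rewrite -mxrank_eq0 -leqn0; apply: leq_trans.
  by rewrite -[rho x]mul1mx; apply: mxrankS (engel_flag_lower_central 0 xL).
by apply: leq_trans (rank_engel_flag _ Lc0) _; lia.
Qed.

End Action.

(** * The Fitting decomposition of [rho x - a] *)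

Section Fitting.
Variables (K : fieldType) (L : lieAlgType K) (m : nat).
Variable rho : {linear L -> 'M[K]_m}.
Hypothesis rho_lie : {morph rho : x y / lie x y >-> mx_lie x y}.
Variable c : nat.
Hypothesis Lc0 : lower_central L c.+1 = 0%VS.
Variables (x : L) (a : K).
Local Notation B := (rho x - a%:M).

(* Moving B past y costs a bracket of y with x, and c brackets give 0. *)
Lemma rep_shift_powl k j M y : y \in lower_central L k.+1 -> (c <= k + j)%N ->
  exists C, rho y *m B ^+ (M + j) = B ^+ M *m C.
Proof.
(* Induction on M + j: once B and y are swapped, the main term has a smaller M, and the bracket term
   trades one unit of j for one more of k. *)
move: {2}(M + j)%N (erefl (M + j)%N) => n.
elim: n k j M y => [|n IHn] k j M y Mj yL ckj.
  exists (rho y *m B ^+ j); have -> : M = 0%N by lia.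
  by rewrite expr0 mul1mx.
case: M => [|M] in Mj *; first by exists (rho y *m B ^+ j); rewrite expr0 mul1mx.
(* At j = 0 one has c <= k, so L^(k+1) = 0 and y = 0. *)
case: j => [|j] in Mj ckj *.
  move: yL; rewrite (lower_central_ge Lc0) ?memv0; last by lia.
  by move=> /eqP ->; exists 0; rewrite linear0 mul0mx mulmx0.
have [C1 eC1] : exists C, rho y *m B ^+ (M + j.+1) = B ^+ M *m C.
  by apply: (IHn k) => //; lia.
have [|||C2 eC2] := IHn k.+1 j M.+1 (lie y x); first by lia.
- exact: lie_lower_central.
- by lia.
exists (C1 + C2); rewrite addSn exprS -mulmxE mulmxA.
have -> : rho y *m B = B *m rho y + rho (lie y x).
  by rewrite mulmxBr mulmxBl rep_comm // scalar_mxC addrAC.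
rewrite mulmxDl -mulmxA eC1 -addSnnS eC2 mulmxDr.
by rewrite exprS -mulmxE mulmxA.
Qed.

(** The mirror image of [rep_shift_powl], which serves for the kernel of B^M; this one makes the
    image stable. *)
Lemma rep_shift_powr k j M y : y \in lower_central L k.+1 -> (c <= k + j)%N ->
  exists C, B ^+ (M + j) *m rho y = C *m B ^+ M.
Proof.
move: {2}(M + j)%N (erefl (M + j)%N) => n.
elim: n k j M y => [|n IHn] k j M y Mj yL ckj.
  exists (B ^+ j *m rho y); have -> : M = 0%N by lia.
  by rewrite expr0 mulmx1.
case: M => [|M] in Mj *; first by exists (B ^+ j *m rho y); rewrite expr0 mulmx1.
case: j => [|j] in Mj ckj *.
  move: yL; rewrite (lower_central_ge Lc0) ?memv0; last by lia.
  by move=> /eqP ->; exists 0; rewrite linear0 mulmx0 mul0mx.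
have [C1 eC1] : exists C, B ^+ (M + j.+1) *m rho y = C *m B ^+ M.
  by apply: (IHn k) => //; lia.
have [|||C2 eC2] := IHn k.+1 j M.+1 (lie x y); first by lia.
- by apply: memv_lie (memvf _) yL.
- by lia.
exists (C1 + C2); rewrite addSn exprSr -mulmxE -mulmxA.
have -> : B *m rho y = rho y *m B + rho (lie x y).
  by rewrite mulmxBr mulmxBl rep_comm // scalar_mxC addrAC.
rewrite mulmxDr mulmxA eC1 -addSnnS eC2 mulmxDl.
by rewrite exprSr -mulmxE !mulmxA.
Qed.

(* For large M the powers B^M and B^2M have the same kernel and image. *)
Lemma fitting_stable : exists M,
  [/\ stable rho (kermx (B ^+ M)), stable rho (B ^+ M),
      (1%:M <= kermx (B ^+ M) + B ^+ M)%MS & (\rank (B ^+ M) <= \rank B)%N].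
Proof.
(* M is doubled until the rank stops dropping. Starting above c allows j = M in the shift lemmas and
   makes M positive, as the last claim requires. *)
have [M cM rM] : exists2 M, (c < M)%N & (\rank (B ^+ M) <= \rank (B ^+ (M + M)))%N.
  suffices step r M : (c < M)%N -> (\rank (B ^+ M) <= r)%N ->
      exists2 M, (c < M)%N & (\rank (B ^+ M) <= \rank (B ^+ (M + M)))%N.
    exact: step (ltnSn c) (rank_leq_row _).
  elim: r M => [|r IHr] M cM rM; first by exists M => //; apply: leq_trans rM _.
  have [?|ltM] := leqP (\rank (B ^+ M)) (\rank (B ^+ (M + M))); first by exists M.
  by apply: (IHr (M + M)%N); lia.
have BM2 : B ^+ (M + M) = B ^+ M *m B ^+ M by rewrite exprD.
have sBM : (B ^+ M <= B ^+ (M + M))%MS.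
  have s2 : (B ^+ (M + M) <= B ^+ M)%MS by rewrite BM2 submxMl.
  by rewrite -(geq_leqif (mxrank_leqif_sup s2)).
have skM : (kermx (B ^+ (M + M)) <= kermx (B ^+ M))%MS.
  have s2 : (kermx (B ^+ M) <= kermx (B ^+ (M + M)))%MS.
    by apply/sub_kermxP; rewrite BM2 mulmxA mulmx_ker mul0mx.
  by rewrite -(geq_leqif (mxrank_leqif_sup s2)) !mxrank_ker leq_sub2l.
exists M; split.
(* If v B^M = 0, then v y B^(2M) = v B^M C = 0, and the kernel of B^(2M) is that of B^M. *)
- move=> y; apply: submx_trans skM; apply/sub_kermxP.
  have [||C eC] := @rep_shift_powl 0 M M y; [exact: memvf|lia|].
  by rewrite -mulmxA eC mulmxA mulmx_ker mul0mx.
- move=> y; have [||C eC] := @rep_shift_powr 0 M M y; [exact: memvf|lia|].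
  by apply: submx_trans (submxMr _ sBM) _; rewrite eC submxMl.
- have /submxP [C eC] := sBM.
  (* Split 1 = (1 - C B^M) + C B^M; since B^M = C B^(2M), the first summand is killed by B^M. *)
  rewrite -[1%:M](subrK (C *m B ^+ M)) addmx_sub_adds ?submxMl //.
  by apply/sub_kermxP; rewrite mulmxBl mul1mx -mulmxA -BM2 -eC subrr.
- case: M cM {rM BM2 sBM skM} => // M _.
  by rewrite exprSr; apply: mxrankM_maxr.
Qed.

End Fitting.

(** * Restriction to a stable subspace *)

Section Restriction.
Variables (K : fieldType) (L : lieAlgType K) (m : nat).
Variable rho : {linear L -> 'M[K]_m}.
Hypothesis rho_lie : {morph rho : x y / lie x y >-> mx_lie x y}.
Variable W : 'M[K]_m.
Hypothesis Wst : stable rho W.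

(** This is the matrix of the action in the basis [row_base W], [pinvmx] recovering coordinates; the
    form of a composite lets linearity be inferred. *)
Definition restr_rep : L -> 'M[K]_(\rank W) :=
  mulmxr (pinvmx (row_base W)) \o (mulmx (row_base W) \o rho).

HB.instance Definition _ := GRing.Linear.on restr_rep.

Lemma restr_repK x : restr_rep x *m row_base W = row_base W *m rho x.
Proof.
rewrite /restr_rep /= mulmxKpV //.
by rewrite (eqmxMr _ (eq_row_base W)) eq_row_base.
Qed.

Lemma restr_rep_lie : {morph restr_rep : x y / lie x y >-> mx_lie x y}.
Proof.
have restrM x y :
    restr_rep x *m restr_rep y *m row_base W = row_base W *m (rho x *m rho y).
  by rewrite -mulmxA restr_repK mulmxA restr_repK mulmxA.
move=> x y; apply: (row_free_inj (row_base_free W)).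
by rewrite restr_repK rho_lie mulmxBr mulmxBl !restrM.
Qed.

Lemma restr_rep_eq0 x : restr_rep x = 0 -> W *m rho x = 0.
Proof.
move=> x0; apply/eqP; rewrite -submx0 -(eqmxMr _ (eq_row_base W)).
by rewrite -restr_repK x0 mul0mx sub0mx.
Qed.

End Restriction.

(** * Subtracting the trace character *)

Section Traceless.
Variables (K : fieldType) (L : lieAlgType K) (m : nat).
Variable rho : {linear L -> 'M[K]_m}.
Hypothesis rho_lie : {morph rho : x y / lie x y >-> mx_lie x y}.

Definition traceless_rep x : 'M[K]_m := rho x - (\tr (rho x) / m%:R)%:M.

Fact traceless_rep_linear : linear traceless_rep.
Proof.
move=> a x y; rewrite /traceless_rep !linearP /=.
by apply/matrixP => i j; rewrite !mxE; case: (i == j); rewrite /= ?mulr1n; ring.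
Qed.

HB.instance Definition _ :=
  GRing.isLinear.Build K L 'M[K]_m *:%R traceless_rep traceless_rep_linear.

Lemma mxtrace_rep_lie x y : \tr (rho (lie x y)) = 0.
Proof. by rewrite rho_lie linearB /= mxtrace_mulC subrr. Qed.

Lemma traceless_rep_lieE x y : traceless_rep (lie x y) = rho (lie x y).
Proof. by rewrite /traceless_rep mxtrace_rep_lie mul0r raddf0 subr0. Qed.

(** Scalar matrices are central, so subtracting them does not change commutators; images of brackets
    have trace 0 and do not change either. *)
Lemma traceless_rep_lie :
  {morph traceless_rep : x y / lie x y >-> mx_lie x y}.
Proof.
move=> x y; rewrite traceless_rep_lieE rho_lie /mx_lie !mulmxBr !mulmxBl.
rewrite !(scalar_mxC _ (rho _)) -!scalar_mxM [X in X%:M](mulrC).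
by apply/matrixP => i j; rewrite !mxE; ring.
Qed.

(** The index k + 2 excludes L itself: from L^2 on every element is a combination of brackets, and
    these have trace 0. *)
Lemma traceless_rep_lower_central k x : x \in lower_central L k.+2 ->
  traceless_rep x = rho x.
Proof.
move=> xL.
have tr0 : \tr (rho x) = 0.
  move: x xL; apply: (@lie_prodv_ind _ _ _ fullv (lower_central L k.+1)).
  - by rewrite !linear0.
  - by move=> a u v u0 v0; rewrite !linearP /= u0 v0 mulr0 addr0.
  - by move=> u v _ _; apply: mxtrace_rep_lie.
by rewrite /traceless_rep tr0 mul0r raddf0 subr0.
Qed.

End Traceless.

(** * Reduction to nilpotent matrices *)

(** If A - a is nilpotent, every eigenvalue b satisfies (b - a)^N = 0. Hence all roots of the
    characteristic polynomial equal a, and the trace is their sum. *)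
Lemma single_eigenvalue_trace (K : closedFieldType) m (A : 'M[K]_m.+1) :
    (forall a, eigenvalue A a -> exists N, (A - a%:M) ^+ N = 0) ->
  exists a N, \tr A = a *+ m.+1 /\ (A - a%:M) ^+ N = 0.
Proof.
move=> Anil; have [r] := closed_field_poly_normal (char_poly A).
rewrite (monicP (char_poly_monic A)) scale1r => chA.
have szr : size r = m.+1.
  by apply: succn_inj; rewrite -(size_prod_XsubC r id) -chA size_char_poly.
have eigA b : b \in r -> eigenvalue A b.
  by rewrite eigenvalue_root_char chA root_prod_XsubC.
case: r szr => // a r [szr] in chA eigA *.
have [N aN] := Anil a (eigA a (mem_head _ _)); exists a, N; split=> //.
have r_a b : b \in a :: r -> b = a.
  move=> /eigA /eigenvalueP [v vA v0]; apply/eqP; rewrite -subr_eq0.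
  have vN k : v *m (A - a%:M) ^+ k = (b - a) ^+ k *: v.
    elim: k => [|k IHk]; first by rewrite !expr0 mulmx1 scale1r.
    rewrite exprSr mulmxA IHk -scalemxAl mulmxBr vA mul_mx_scalar.
    by rewrite -scalerBl scalerA -exprSr.
  have /eqP := vN N; rewrite aN mulmx0 eq_sym scaler_eq0 (negPf v0) orbF.
  by rewrite expf_eq0 => /andP [].
have := char_poly_trace A (ltn0Sn m).
rewrite chA -[in m.+1.-1]szr coefPn_prod_XsubC // => /oppr_inj <-.
rewrite big_seq (eq_bigr (fun=> a)) => [|b /r_a //].
by rewrite -big_seq big_const_seq count_predT iter_addr_0 /= szr.
Qed.

(* The class is at least 2 so that the trace vanishes on the last nonzero term
   of the series; a nonzero abelian L has a nonzero representation on K. *)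
Lemma rep_lower_central_eq0 (K : numClosedFieldType) (L : lieAlgType K) c m
    (rho : {linear L -> 'M[K]_m}) x :
    {morph rho : x y / lie x y >-> mx_lie x y} ->
    lower_central L c.+3 = 0%VS -> (m <= c.+2)%N ->
  x \in lower_central L c.+2 -> rho x = 0.
Proof.
move=> + Lc0 + xL.
elim/ltn_ind: m rho => -[|m] IHm rho rho_lie mc.
  by apply/matrixP => -[].
have [//|nz] := eqVneq (rho x) 0.
rewrite -(traceless_rep_lower_central rho_lie xL).
apply: (nilrep_lower_central_eq0 (traceless_rep_lie rho_lie) _ Lc0 mc xL) => y.
have [a|a [N [tr_a aN]]] := @single_eigenvalue_trace _ _ (rho y); last first.
  by exists N; rewrite /= /traceless_rep tr_a -[a *+ _]mulr_natr mulfK ?pnatr_eq0.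
move=> eig_a.
(* It remains to see that [rho y - a%:M] is nilpotent. Its N-th power has a proper image, a being an
   eigenvalue; if that power were nonzero, its kernel would be proper too, and by induction x would
   act as 0 on both summands. *)
have [N [kst ist sum1 rN]] := fitting_stable rho_lie Lc0 y a.
exists N; apply: contraNeq nz => BN0.
have {}rN : (\rank ((rho y - a%:M) ^+ N) < m.+1)%N.
  apply: leq_ltn_trans rN _; rewrite ltnNge; apply/negP => full.
  move: eig_a; rewrite /eigenvalue /eigenspace kermx_eq0 /row_free.
  by rewrite eqn_leq rank_leq_row full.
have kill (W : 'M_m.+1) : stable rho W -> (\rank W < m.+1)%N -> W *m rho x = 0.
  move=> Wst rW; apply: (restr_rep_eq0 Wst); apply: IHm => //.
    exact: restr_rep_lie.
  by apply: leq_trans mc; apply: ltnW.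
rewrite -submx0 -[rho x]mul1mx; apply: submx_trans (submxMr _ sum1) _.
rewrite addsmxMr !kill ?addsmx0 ?submx_refl //.
by rewrite mxrank_ker ltn_subrL lt0n mxrank_eq0 BN0.
Qed.

(** * The faithful homomorphism [phi] *)

Lemma mulmx_unit (K : fieldType) p q r i j k l :
  unit_mx K p q i j *m unit_mx K q r k l =
  ((j == k) && (0 < j <= q)%N)%:R *: unit_mx K p r i l.
Proof.
apply/matrixP => a b; rewrite !mxE; under eq_bigr do rewrite !mxE.
(* An index j out of range makes the left factor zero, hence the range condition in the
   coefficient. *)
have [jq|jq] := boolP (0 < j <= q)%N; last first.
  rewrite andbF mul0r big1 // => s _; case: eqP => _; rewrite ?mul0r //=.
  by case: eqP => [sj|_]; rewrite ?mul0r //; move: jq (ltn_ord s); lia.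
have jq' : (j.-1 < q)%N by lia.
rewrite (bigD1 (Ordinal jq')) //= big1 => [|s]; last first.
  rewrite -val_eqE /= => sj; have -> : (s.+1 == j) = false by lia.
  by rewrite andbF mul0r.
have -> : j.-1.+1 = j by lia.
by rewrite addr0 eqxx !andbT -!natrM !mulnb; congr _%:R; lia.
Qed.

Section Phi.
Variables (K : fieldType) (n : nat).
Local Notation N := n.*2.
Local Notation E := (unit_mx K N N).

Fact phi_linear : linear (@phi K n).
Proof.
move=> a x y; rewrite /phi.
have -> (F : nat -> 'M[K]_N) :
    \sum_(2 <= i < N) qcoord i (a *: x + y) *: F i =
    a *: (\sum_(2 <= i < N) qcoord i x *: F i)
      + \sum_(2 <= i < N) qcoord i y *: F i.
  rewrite scaler_sumr -big_split; apply: eq_bigr => i _ /=.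
  by rewrite qcoordD qcoordZ scalerDl scalerA.
rewrite !qcoordD !qcoordZ; move: (\sum_(2 <= k < _) unit_mx _ _ _ _ _) => X.
move: (\sum_(_ <= _ < _) _) (\sum_(_ <= _ < _) _) => S T.
by apply/matrixP => i j; rewrite !mxE; ring.
Qed.

HB.instance Definition _ :=
  GRing.isLinear.Build K (Qfil K n) (gl K N) *:%R (@phi K n) phi_linear.

Hypothesis n1 : (1 < n)%N.

(** The image of e_1 is a nilpotent Jordan block on the indices 2, ..., 2n - 1, so multiplying by it
    shifts one index of a matrix unit or gives 0. *)
Lemma phi_e1_mull j l :
  phi (qe K n 1) *m E j l = (2 < j < N)%:R *: E j.-1 l.
Proof.
rewrite phi_e1 // mulmx_suml; under eq_bigr do rewrite mulmx_unit.
have [jN|jN] := boolP (2 < j < N)%N; last first.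
  rewrite scale0r big_nat big1 // => k k2.
  by case: andP => [[/eqP kj _]|_]; [lia | rewrite scale0r].
rewrite (bigD1_seq j.-1) ?iota_uniq ?mem_index_iota /=; [|lia|by []].
rewrite big1 => [|k kj]; last first.
  have -> : (k.+1 == j) = false by lia.
  by rewrite scale0r.
by rewrite addr0; congr (_%:R *: _); lia.
Qed.

Lemma phi_e1_mulr j l :
  E j l *m phi (qe K n 1) = (1 < l < N.-1)%:R *: E j l.+1.
Proof.
rewrite phi_e1 // mulmx_sumr; under eq_bigr do rewrite mulmx_unit.
have [lN|lN] := boolP (1 < l < N.-1)%N; last first.
  rewrite scale0r big_nat big1 // => k k2.
  by case: andP => [[/eqP kj _]|_]; [lia | rewrite scale0r].
rewrite (bigD1_seq l) ?iota_uniq ?mem_index_iota /=; [|lia|by []].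
rewrite big1 => [|k kj]; last first.
  have -> : (l == k) = false by lia.
  by rewrite scale0r.
by rewrite addr0; congr (_%:R *: _); lia.
Qed.

(** Three cases: for j = 2n, E_(1,2n) is annihilated on both sides; for i = 1, the Jordan block
    shifts the two units of the image of e_j; otherwise only products of a first-row unit with a
    last-column unit survive. *)
Lemma phi_lie_e i j : (1 <= i <= j)%N -> (j <= N)%N ->
  phi (lie (qe K n i) (qe K n j)) = lie (phi (qe K n i)) (phi (qe K n j)).
Proof.
move=> ij jN; have [->|ne_ij] := eqVneq i j; first by rewrite !liexx linear0.
have [j_N|ltjN] := eqVneq j N.
  rewrite qlie_other; [|lia..]; rewrite linear0 j_N phi_e2n // lieZr.
  rewrite {1}/lie /= /mx_lie; have [->|i1] := eqVneq i 1%N.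
    rewrite phi_e1_mull phi_e1_mulr.
    have -> : (1 < N < N.-1)%N = false by lia.
    by rewrite !scale0r subrr scaler0.
  rewrite phi_ei; last by lia.
  rewrite mulmxDl mulmxDr -scalemxAl -scalemxAr !mulmx_unit.
  have -> : (i == 1)%N = false by lia.
  have -> : (N == 1)%N = false by lia.
  have -> : (N == (N - i).+1)%N = false by lia.
  by rewrite !(scale0r, scaler0, addr0, subr0).
rewrite {2}/lie /= /mx_lie; have [i1|i1] := eqVneq i 1%N.
  rewrite i1 (@phi_ei _ _ j); last by lia.
  move: (phi (qe K n 1)) phi_e1_mull phi_e1_mulr => X XE EX.
  rewrite mulmxDl mulmxDr -scalemxAl -scalemxAr !XE !EX.
  have [jN2|jN2] := leqP j (N - 2).
    rewrite qlie_e1 ?phi_ei; [|lia..].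
    have -> : (2 < (N - j).+1 < N)%N by lia.
    have -> : (1 < j < N.-1)%N by lia.
    have -> : (1 < N < N.-1)%N = false by lia.
    (* The minus sign of the commutator turns (-1)^j into (-1)^(j+1) at E_(1,j+1): this is why the
       signs of the first row alternate. *)
    rewrite !(scale0r, scaler0, scale1r, add0r, addr0) exprS mulN1r scaleNr addrC.
    by congr (E _ _ - _); lia.
  rewrite qlie_other ?linear0; [|lia..].
  have -> : (2 < (N - j).+1 < N)%N = false by lia.
  have -> : (1 < j < N.-1)%N = false by lia.
  have -> : (1 < N < N.-1)%N = false by lia.
  by rewrite !(scale0r, scaler0, addr0, subrr).
rewrite !phi_ei; [|lia..].
rewrite !mulmxDl !mulmxDr -!scalemxAl -!scalemxAr !mulmx_unit.
have -> : (i == 1)%N = false by lia.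
have -> : (j == 1)%N = false by lia.
have -> : (N == 1)%N = false by lia.
have -> : (N == (N - i).+1)%N = false by lia.
have -> : (N == (N - j).+1)%N = false by lia.
rewrite !(scale0r, scaler0, add0r, addr0) !scalerA.
(* When i + j = 2n + 1, i and j have opposite parity, so the two products add up to 2 (-1)^i
   E_(1,2n), which the factor -2 in the image of e_2n matches. *)
have [eij|nij] := eqVneq (i + j)%N N.+1; last first.
  rewrite qlie_other ?linear0; [|lia..].
  have -> : (i == (N - j).+1)%N = false by lia.
  have -> : (j == (N - i).+1)%N = false by lia.
  by rewrite !mulr0 !scale0r subrr.
have -> : j = (N.+1 - i)%N by lia.
rewrite lieC qlie_mirror; last by lia.
rewrite -scaleNr linearZ /= phi_e2n // scalerA -scalerBl; congr (_ *: _).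
have -> : (i == (N - (N.+1 - i)).+1)%N && (0 < i <= N)%N by lia.
have -> : (N.+1 - i == (N - i).+1)%N && (0 < N.+1 - i <= N)%N by lia.
rewrite -[in _ ^+ (_ - _)]signr_odd oddB; last by lia.
by rewrite /= odd_double /= -[_ ^+ i]signr_odd; case: (odd i) => /=; ring.
Qed.

Lemma phi_lie : {morph @phi K n : x y / lie x y}.
Proof.
have phi_e i j : (1 <= i < N.+1)%N -> (1 <= j < N.+1)%N ->
    phi (lie (qe K n i) (qe K n j)) = lie (phi (qe K n i)) (phi (qe K n j)).
  move=> iN jN; have [ij|ji] := leqP i j; first by apply: phi_lie_e; lia.
  by rewrite lieC linearN /= phi_lie_e -?lieC //; lia.
have phi_sum x : phi x = \sum_(1 <= i < N.+1) qcoord i x *: phi (qe K n i).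
  by rewrite {1}(qbasis_sum x) linear_sum; apply: eq_bigr => i _; rewrite linearZ.
move=> x y; rewrite (phi_sum x) (phi_sum y) {1}(qbasis_sum x) {1}(qbasis_sum y).
rewrite !lie_suml linear_sum; apply: eq_big_nat => i iN.
rewrite !lie_sumr linear_sum; apply: eq_big_nat => j jN.
rewrite !(lieZl, lieZr) [LHS]linearZ; congr (_ *: _).
by rewrite [LHS]linearZ /= phi_e.
Qed.

Lemma phi_coef (x : Qfil K n) (a b : 'I_N) : (phi x : 'M[K]_N) a b =
  qcoord 1 x * \sum_(2 <= k < N.-1) ((a.+1 == k) && (b.+1 == k.+1))%:R
  + \sum_(2 <= i < N) qcoord i x * ((-1) ^+ i * ((a.+1 == 1) && (b.+1 == i))%:R
      + ((a.+1 == (N - i).+1) && (b.+1 == N))%:R)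
  + qcoord N x * (- 2%:R * ((a.+1 == 1) && (b.+1 == N))%:R).
Proof.
rewrite /phi !mxE !summxE; congr (_ * _ + _ + _).
  by apply: eq_bigr => k _; rewrite mxE.
by apply: eq_bigr => k _; rewrite !mxE.
Qed.

(** Each coordinate is read off one entry: a_1 at (2,3), -2 a_2n at (1,2n), where 2 must be
    cancelled, and (-1)^k a_k at (1,k) for the others. *)
Lemma phi_inj : 2%:R != 0 :> K -> injective (@phi K n).
Proof.
move=> nz2; apply: raddf_inj => x x0; apply: qcoordP => k kN; rewrite qcoord0.
have coef0 (a b : 'I_N) : (phi x : 'M[K]_N) a b = 0 by rewrite x0 mxE.
have N0 : (0 < N)%N by lia.
have [k1|k1] := eqVneq k 1%N.
  have lt1 : (1 < N)%N by lia.
  have lt2 : (2 < N)%N by lia.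
  (* Ordinals count from 0, so this is the entry (2,3). *)
  have := coef0 (Ordinal lt1) (Ordinal lt2); rewrite phi_coef /=.
  rewrite (bigD1_seq 2%N) ?iota_uniq ?mem_index_iota /=; [|lia|by []].
  rewrite big1 => [|i i2]; last by have -> : (2 == i)%N = false by lia.
  rewrite big1 => [|i _]; last first.
    have -> : (3 == N)%N = false by lia.
    by rewrite andbF mulr0 addr0 mulr0.
  by rewrite k1 !mulr0 !addr0 mulr1.
have [k_N|k_N] := eqVneq k N.
  have ltN : (N.-1 < N)%N by lia.
  have := coef0 (Ordinal N0) (Ordinal ltN); rewrite phi_coef /=.
  rewrite prednK // eqxx.
  rewrite [X in _ * X]big_nat [X in _ * X]big1 => [|i i2]; last first.
    by have -> : (1 == i)%N = false by lia.
  rewrite [X in _ + X + _]big_nat [X in _ + X + _]big1 => [|i i2]; last first.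
    have -> : (N == i)%N = false by lia.
    have -> : (1 == (N - i).+1)%N = false by lia.
    by rewrite mulr0 addr0 mulr0.
  rewrite mulr0 !add0r mulr1 -k_N => /eqP.
  by rewrite mulf_eq0 oppr_eq0 (negPf nz2) orbF => /eqP.
have ltk : (k.-1 < N)%N by lia.
have := coef0 (Ordinal N0) (Ordinal ltk); rewrite phi_coef /=.
have -> : k.-1.+1 = k by lia.
have -> : (k == N)%N = false by lia.
rewrite [X in _ * X]big_nat [X in _ * X]big1 => [|i i2]; last first.
  by have -> : (1 == i)%N = false by lia.
rewrite (bigD1_seq k) ?iota_uniq ?mem_index_iota /=; [|lia|by []].
rewrite big1 => [|i ik]; last first.
  have -> : (k == i)%N = false by lia.
  by rewrite andbF mulr0 addr0 mulr0.
rewrite eqxx andbF !mulr0 add0r !addr0 mulr1 => /eqP.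
by rewrite mulf_eq0 signr_eq0 orbF => /eqP.
Qed.

End Phi.

(** * Minimality of the dimension 2n *)

Theorem proposition2 (R : realType) (n : nat) (hn : (2 <= n)%N) :
  minimal_faithful_rep (@phi R[i] n).
Proof.
have phi_faithful : faithful_rep (@phi R[i] n).
  split; last by apply: phi_inj => //; rewrite pnatr_eq0.
  by split; [apply: phi_linear | apply: phi_lie].
do 2!split=> //; first by exists (@phi R[i] n).
move=> m rho [[rho_lin rho_lie] rho_inj]; rewrite leqNgt; apply/negP => ltm.
pose rhoM := GRing.isLinear.Build R[i] (Qfil R[i] n) 'M[R[i]]_m *:%R rho rho_lin.
pose rhoL : {linear Qfil R[i] n -> 'M[R[i]]_m} := HB.pack rho rhoM.
have e_last : qe R[i] n n.*2 \in lower_central (Qfil R[i] n) n.*2.-1.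
  rewrite lower_centralQ //; last by lia.
  by apply/qtailP => j jn; rewrite qcoord_e0 //; apply/eqP; lia.
have top0 : lower_central (Qfil R[i] n) n.*2 = 0%VS.
  rewrite lower_centralQ //; last by lia.
  by apply/eqP; rewrite -dimv_eq0 dim_qtail // subnn.
have rho_e0 : rhoL (qe R[i] n n.*2) = 0.
  (* The value 2n - 3 makes c + 3 and c + 2 equal to 2n and 2n - 1, the indices of the zero term and
     of the last nonzero term; n >= 2 keeps the subtraction exact. *)
  apply: (@rep_lower_central_eq0 _ _ (n.*2 - 3) _ rhoL).
  - exact: rho_lie.
  - by rewrite (_ : (n.*2 - 3).+3 = n.*2) //; lia.
  - by lia.
  - by rewrite (_ : (n.*2 - 3).+2 = n.*2.-1) //; lia.
have e0 : qe R[i] n n.*2 = 0 by apply/rho_inj/(etrans rho_e0)/esym/(linear0 rhoL).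
have : qcoord n.*2 (qe R[i] n n.*2) = 1 by rewrite qcoord_ee //; lia.
by rewrite e0 qcoord0 => /esym/eqP; rewrite oner_eq0.
Qed.
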